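(* Let $p$ be a prime, let $n\ge 3$ be an integer not divisible by $p$, let $c>0$ be a real constant, and let $k$ be a positive integer. If $$k > \frac{\log n}{\log p}\left( (\log n)^{\frac{p+c-cp}{c(p-1)}} - 1\right),$$ then $g(n,k,p) < c$, where $$g(n,k,p) = \frac{\sigma(p^k)}{p^k}\left(1 + \frac{\log\left(1+\frac{k\log p}{\log n}\right)}{\log\log n}\right)^{-1}.$$
   Context: $\sigma(m)$ denotes the sum of the positive divisors of $m$ and $\log$ is the natural logarithm. With $f(m)=\frac{\sigma(m)}{m\log\log m}$, one has $f(p^kn)=g(n,k,p)f(n)$ when $p\nmid n$. *)

(* Defs.v *)
From mathcomp Require Import all_boot all_order all_algebra.
From mathcomp Require Import reals exp.
Set Implicit Arguments.
Unset Strict Implicit.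
Unset Printing Implicit Defensive.
Import Order.TTheory GRing.Theory Num.Theory.
Local Open Scope ring_scope.

Definition sigma (m : nat) : nat := (\sum_(d <- divisors m) d)%N.

Definition g (R : realType) (n k p : nat) : R :=
  (sigma (p ^ k))%:R / (p ^ k)%:R
  * (1 + ln (1 + k%:R * ln p%:R / ln n%:R) / ln (ln n%:R))^-1.

(* Main.v *)
(* Write L = ln n, which exceeds 1 because exp 1 < 3. The hypothesis on k says exactly
   that 1 + k ln p / L > L^e with e = (p + c - cp) / (c(p-1)). Taking logarithms,
   the factor inverted in g exceeds 1 + e = p / (c(p-1)), while the geometric sum
   gives sigma(p^k) / p^k < p / (p-1); the quotient is therefore less than c. *)
Require Import Defs.
From mathcomp Require Import all_boot all_order all_algebra.
From mathcomp Require Import reals sequences exp.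
From mathcomp Require Import ring lra.
Set Implicit Arguments.
Unset Strict Implicit.
Unset Printing Implicit Defensive.
Import Order.TTheory GRing.Theory Num.Theory.
Local Open Scope ring_scope.

Lemma sigma_pfactor (p k : nat) (p_prime : prime p) :
  sigma (p ^ k) = (\sum_(i < k.+1) p ^ i)%N.
Proof.
rewrite /sigma -(big_mkord xpredT (fun i => p ^ i)%N) -(big_map (expn p) xpredT id).
(* Both lists are duplicate-free, the powers because [expn p] is injective for [p > 1], so comparing
   members suffices. *)
apply: perm_big; apply: uniq_perm => [||d]; first exact: divisors_uniq.
  by rewrite map_inj_uniq ?iota_uniq//; apply: expnI; apply: prime_gt1.
rewrite -dvdn_divisors ?expn_gt0 ?prime_gt0//.
apply/(dvdn_pfactor _ _ p_prime)/mapP => -[i ik ->]; exists i => //;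
  by move: ik; rewrite mem_index_iota.
Qed.

(** Clearing denominators leaves [(p - 1) * sigma (p ^ k) = p ^ k.+1 - 1 < p ^ k.+1] in the
    naturals. *)
Lemma sigma_pfactor_ratio_lt (R : realFieldType) (p k : nat) (p_prime : prime p) :
  (sigma (p ^ k))%:R / (p ^ k)%:R < p%:R / (p%:R - 1) :> R.
Proof.
have p1 : 1 < p%:R :> R by rewrite ltr1n prime_gt1.
have pk0 : 0 < (p ^ k)%:R :> R by rewrite ltr0n expn_gt0 prime_gt0.
rewrite ltr_pdivlMr ?subr_gt0// mulrAC ltr_pdivrMr//.
rewrite -(natrB _ (prime_gt0 p_prime)) -!natrM ltr_nat subn1.
rewrite sigma_pfactor// mulnC -predn_exp expnS ltn_predL muln_gt0.
by rewrite expn_gt0 !prime_gt0.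
Qed.

Lemma ln_gt1 (R : realType) (n : nat) (n_ge3 : (3 <= n)%N) : 1 < ln n%:R :> R.
Proof.
have n0 : 0 < n%:R :> R by rewrite ltr0n (leq_trans _ n_ge3).
rewrite -ltr_expR lnK ?posrE//.
apply: (@lt_le_trans _ _ 3%:R); last by rewrite ler_nat.
(* [expR 1 = expR (- 1/6) ^- 6 <= (6/5)^6 < 3] *)
have e6 : 5%:R / 6%:R <= expR (- 6%:R^-1) :> R.
  by apply: le_trans (expR_ge1Dx _); lra.
have -> : expR 1 = (expR (- 6%:R^-1) ^+ 6)^-1 :> R.
  by rewrite -expRM_natl -expRN; congr expR; field.
rewrite invf_plt ?posrE ?exprn_gt0 ?expR_gt0 ?ltr0n//.
(* 6 is the least [m > 1] with [(m / (m - 1)) ^ m < 3]. *)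
apply: (@lt_le_trans _ _ ((5%:R / 6%:R) ^+ 6)); first by lra.
by rewrite lerXn2r ?nnegrE ?expR_ge0//; lra.
Qed.

Theorem theorem5p8 (R : realType) (p n k : nat) (c : R)
    (p_prime : prime p) (n_ge3 : (3 <= n)%N) (p_ndvd_n : ~~ (p %| n)%N)
    (c_gt0 : 0 < c) (k_gt0 : (0 < k)%N)
    (k_large :
      ln n%:R / ln p%:R
        * (ln n%:R `^ ((p%:R + c - c * p%:R) / (c * (p%:R - 1))) - 1)
      < k%:R) :
  g R n k p < c.
Proof.
have sigma_lt := sigma_pfactor_ratio_lt R k p_prime.
have L1 : 1 < ln n%:R :> R := ln_gt1 R n_ge3.
have p1 : 1 < p%:R :> R by rewrite ltr1n prime_gt1.
have lnp0 : 0 < ln p%:R :> R by exact: ln_gt0.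
rewrite /g; set e := (_ / (c * _)) in k_large.
move: sigma_lt L1 k_large; set s := _%:R / _; set L := ln n%:R.
move=> sigma_lt L1 k_large.
have L0 : 0 < L by apply: lt_trans L1.
have LL0 : 0 < ln L by exact: ln_gt0.
have powL_lt : L `^ e < 1 + k%:R * ln p%:R / L.
  by rewrite -ltrBlDl ltr_pdivlMr// -ltr_pdivrMr// mulrAC mulrC mulrA mulrAC.
(* Dividing by [ln L] keeps the direction only because [L > 1]. *)
have e_lt : e < ln (1 + k%:R * ln p%:R / L) / ln L.
  rewrite ltr_pdivlMr// -(ln_powR L e) ltr_ln ?posrE ?powR_gt0//.
  by apply: lt_trans powL_lt; exact: powR_gt0.
(* The numerators add up to [c(p-1) + (p + c - cp) = p]. *)
have e1 : 1 + e = p%:R / (p%:R - 1) / c.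
  by rewrite /e; field; rewrite subr_eq0 !gt_eqF.
have e1_gt0 : 0 < 1 + e.
  by rewrite e1 !divr_gt0 ?subr_gt0//; apply: lt_trans p1.
have denom_gt : 1 + e < 1 + ln (1 + k%:R * ln p%:R / L) / ln L by rewrite ltrD2l.
(* With [D] the factor inverted in [g], the chain is [s < p / (p-1) = c(1 + e) < c D]. *)
rewrite ltr_pdivrMr ?(lt_trans e1_gt0)//.
apply: (lt_trans sigma_lt); rewrite [ltRHS]mulrC -ltr_pdivrMr//.
by rewrite -e1.
Qed.
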